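(* For $\mathcal{A}_4$ with the cyclic conjugacy class $\mathcal{C}=\{t,x,y,z\}$, $t=(123)$, $x=(134)$, $y=(243)$, $z=(142)$, the first noncommutative de Rham cohomology is $$H^1(\mathcal{A}_4)=\mathbb{C}.\theta,$$ i.e. it is one-dimensional over $\mathbb{C}$ and spanned by the class of $\theta=\sum_{a\in\mathcal{C}}e_a$.
   Context: $\mathcal{A}_4$ is the alternating group of order 12. $H=\mathbb{C}[\mathcal{A}_4]$ is the algebra of complex functions on $\mathcal{A}_4$, and $(R_af)(g)=f(ga)$. $\Omega^1(H)$ is the free left $H$-module with basis $\{e_a\}_{a\in\mathcal{C}}$, with right module structure $e_af=R_a(f)e_a$, and $\mathrm{d}:H\to\Omega^1(H)$ is $\mathrm{d}f=\sum_{a\in\mathcal{C}}(R_af-f)e_a$. Let $\Psi$ be the $H$-bimodule map on $\Omega^1(H)\otimes_H\Omega^1(H)$ with $\Psi(e_a\otimes_H e_b)=e_{aba^{-1}}\otimes_H e_a$. Then $\Omega^2(H)=(\Omega^1(H)\otimes_H\Omega^1(H))/\ker(\mathrm{id}-\Psi)$, with $\wedge$ the image in the quotient, and $\mathrm{d}:\Omega^1(H)\to\Omega^2(H)$ is the $\mathbb{C}$-linear map with $\mathrm{d}(fe_a)=\mathrm{d}f\wedge e_a+f\,\mathrm{d}e_a$ and $\mathrm{d}e_a=\theta\wedge e_a+e_a\wedge\theta$. The first cohomology is closed 1-forms modulo exact ones: $H^1(\mathcal{A}_4)=\ker(\mathrm{d}|_{\Omega^1(H)})/\mathrm{d}(H)$.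 *)

(* Defs.v *)
From HB Require Import structures.
From mathcomp Require Import all_boot all_order all_algebra.
From mathcomp Require Import all_fingroup all_solvable.
From mathcomp Require Import generic_quotient ring_quotient.

Set Implicit Arguments.
Unset Strict Implicit.
Unset Printing Implicit Defensive.

Import GRing.Theory.
Local Open Scope ring_scope.

(* The quotient space vT / W, with projection vpi. *)
Section QuotientSpace.
Variables (K : fieldType) (vT : vectType K) (W : {vspace vT}).

Definition vquot : Type := Quotient.quot (pred_of_vspace W).
HB.instance Definition _ := GRing.Zmodule.on vquot.

Definition vpi (u : vT) : vquot := \pi_(Quotient.quot (pred_of_vspace W))%qT u.
Definition vrepr (q : vquot) : vT := repr q.

Lemma vreprK : cancel vrepr vpi.
Proof. by move=> q; apply: reprK. Qed.

Lemma vpi_eq u v : (vpi u == vpi v) = (u - v \in W).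
Proof. by rewrite Quotient.idealrBE. Qed.

Lemma vpiB : {morph vpi : u v / u - v}.
Proof. exact: (raddfB (\pi_(Quotient.quot (pred_of_vspace W))%qT)). Qed.

Lemma vpiD : {morph vpi : u v / u + v}.
Proof. exact: (raddfD (\pi_(Quotient.quot (pred_of_vspace W))%qT)). Qed.

Lemma vrepr_vpi u : vrepr (vpi u) - u \in W.
Proof. by rewrite -vpi_eq vreprK. Qed.

Definition vquot_scale (c : K) (q : vquot) : vquot := vpi (c *: vrepr q).

Lemma vquot_scale_vpi c u : vquot_scale c (vpi u) = vpi (c *: u).
Proof.
by apply/eqP; rewrite vpi_eq -scalerBr memvZ // vrepr_vpi.
Qed.

Fact vquot_scaleA c c' q :
  vquot_scale c (vquot_scale c' q) = vquot_scale (c * c') q.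
Proof. by rewrite -[q]vreprK !vquot_scale_vpi scalerA. Qed.
Fact vquot_scale1 : left_id 1 vquot_scale.
Proof. by move=> q; rewrite -[q]vreprK vquot_scale_vpi scale1r. Qed.
Fact vquot_scaleDr : right_distributive vquot_scale +%R.
Proof.
move=> c p q; rewrite -[p]vreprK -[q]vreprK -vpiD !vquot_scale_vpi.
by rewrite -vpiD scalerDr.
Qed.
Fact vquot_scaleDl q : {morph vquot_scale^~ q : c c' / c + c'}.
Proof.
by move=> c c'; rewrite -[q]vreprK !vquot_scale_vpi -vpiD scalerDl.
Qed.
HB.instance Definition _ := GRing.Zmodule_isLmodule.Build K vquot
  vquot_scaleA vquot_scale1 vquot_scaleDr vquot_scaleDl.

Fact vpi_is_linear : linear vpi.
Proof. by move=> c u v; rewrite vpiD -vquot_scale_vpi. Qed.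
HB.instance Definition _ := GRing.isLinear.Build K vT vquot _ vpi vpi_is_linear.

Lemma vpi_eq0 u : (vpi u == 0) = (u \in W).
Proof. by rewrite -(linear0 vpi) vpi_eq subr0. Qed.

Fact vquot_vect_iso : Vector.axiom (\dim (W^C)) vquot.
Proof.
have cap0 : (W^C :&: W = 0)%VS by rewrite capvC capv_compl.
have piW w : w \in W -> daddv_pi (W^C) W w = 0.
  move=> Ww; have := @daddv_pi_add _ _ (W^C)%VS W w cap0.
  rewrite addvC addv_complf memvf => /(_ isT).
  by rewrite (@daddv_pi_id _ _ W) ?capv_compl // => /(canRL (addrK _)) ->; rewrite subrr.
have piE w : vpi (daddv_pi (W^C) W w) = vpi w.
  apply/eqP; rewrite vpi_eq -[X in _ - X](@daddv_pi_add _ _ (W^C)%VS W w cap0).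
    by rewrite opprD addNKr memvN memv_pi.
  by rewrite addvC addv_complf memvf.
have pirE u : daddv_pi (W^C) W (vrepr (vpi u)) = daddv_pi (W^C) W u.
  by have /piW := vrepr_vpi u; rewrite linearB => /eqP; rewrite subr_eq0 => /eqP.
exists (fun q => \row_i coord (vbasis (W^C)) i (daddv_pi (W^C) W (vrepr q))).
  move=> c p q; apply/rowP=> i; rewrite !mxE -linearP -linearP.
  by rewrite -{1}[p]vreprK -{1}[q]vreprK -linearP pirE.
exists (fun r : 'rV_(\dim (W^C)) => vpi (\sum_i r 0 i *: (vbasis (W^C))`_i)).
  move=> q; rewrite -[RHS]vreprK -[RHS]piE; congr vpi.
  rewrite [RHS](coord_vbasis (memv_pi _ _ _)).
  by apply: eq_bigr => i _; rewrite mxE.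
move=> r; apply/rowP=> i; rewrite mxE pirE daddv_pi_id //.
  by rewrite coord_sum_free ?(basis_free (vbasisP _)).
by apply: rpred_sum => j _; rewrite rpredZ ?vbasis_mem ?memt_nth.
Qed.
HB.instance Definition _ := Lmodule_hasFinDim.Build K vquot vquot_vect_iso.

End QuotientSpace.

Section Forms.
Variables (K : fieldType) (gT : finGroupType) (C : {set gT}).

(* The functions on gT; the regular module K^o supplies the vector space
   structure, and the ring structure is the pointwise one. *)
Local Notation H := {ffun gT -> K^o}.
Local Notation cls := {a | a \in C}.
(* A 1-form \sum_a w_a e_a is the family (w_a), an element
   \sum_(a, b) w_(a, b) e_a (x) e_b of the tensor square the family w_(a, b). *)
Local Notation Om1 := {ffun cls -> H}.
Local Notation Om11 := {ffun cls * cls -> H}.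

Definition Rt (a : gT) (f : H) : H := [ffun g => f (g * a)%g].

Definition e1 (a : cls) : Om1 := [ffun s => if s == a then 1 else 0].
Definition lmul1 (f : H) (w : Om1) : Om1 := [ffun s => f * w s].
Definition rmul1 (w : Om1) (f : H) : Om1 := [ffun s => w s * Rt (val s) f].

Definition theta : Om1 := \sum_a e1 a.

Definition d0 (f : H) : Om1 := \sum_a lmul1 (Rt (val a) f - f) (e1 a).

(* (\sum_a w_a e_a) (x) (\sum_b v_b e_b) = \sum_(a, b) w_a R_a(v_b) e_a (x) e_b;
   see tens_universal. *)
Definition tens (w v : Om1) : Om11 := [ffun s => w s.1 * Rt (val s.1) (v s.2)].
Definition lmul11 (f : H) (w : Om11) : Om11 := [ffun s => f * w s].
Definition rmul11 (w : Om11) (f : H) : Om11 :=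
  [ffun s => w s * Rt (val s.1) (Rt (val s.2) f)].

Lemma RtD a : {morph Rt a : f g / f + g}.
Proof. by move=> f g; apply/ffunP=> x; rewrite !ffunE. Qed.
Lemma RtM a : {morph Rt a : f g / f * g}.
Proof. by move=> f g; apply/ffunP=> x; rewrite !ffunE. Qed.
Lemma RtB a : {morph Rt a : f g / f - g}.
Proof. by move=> f g; apply/ffunP=> x; rewrite !ffunE. Qed.
Lemma Rt1 a : Rt a 1 = 1.
Proof. by apply/ffunP=> x; rewrite !ffunE. Qed.
Lemma Rt0 a : Rt a 0 = 0.
Proof. by apply/ffunP=> x; rewrite !ffunE. Qed.
Lemma RtZ a c f : Rt a (c *: f) = c *: Rt a f.
Proof. by apply/ffunP=> x; rewrite !ffunE. Qed.
Lemma RtRt a b f : Rt a (Rt b f) = Rt (a * b)%g f.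
Proof. by apply/ffunP=> x; rewrite !ffunE mulgA. Qed.

Lemma sum_e1 (w : Om1) : w = \sum_a lmul1 (w a) (e1 a).
Proof.
apply/ffunP=> s; rewrite sum_ffunE (bigD1 s) //= !ffunE eqxx mulr1.
by rewrite big1 ?addr0 // => a nas; rewrite !ffunE eq_sym (negPf nas) mulr0.
Qed.

Lemma rmul1_e1 a f : rmul1 (e1 a) f = lmul1 (Rt (val a) f) (e1 a).
Proof.
by apply/ffunP=> s; rewrite !ffunE; case: eqP => [->|]; rewrite (mul1r, mul0r) (mulr1, mulr0).
Qed.

Lemma thetaE a : theta a = 1.
Proof.
rewrite /theta sum_ffunE (bigD1 a) //= ffunE eqxx.
by rewrite big1 ?addr0 // => b nba; rewrite ffunE eq_sym (negPf nba).
Qed.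

Lemma d0E f a : d0 f a = Rt (val a) f - f.
Proof.
rewrite /d0 sum_ffunE (bigD1 a) //= !ffunE eqxx mulr1.
by rewrite big1 ?addr0 // => b nba; rewrite !ffunE eq_sym (negPf nba) mulr0.
Qed.

Fact d0_is_linear : linear d0.
Proof.
move=> c f g; apply/ffunP=> a; rewrite !(d0E, ffunE) RtD RtZ.
by rewrite scalerBr opprD addrACA.
Qed.
HB.instance Definition _ := GRing.isLinear.Build K H Om1 _ d0 d0_is_linear.

Definition dRclass : 'Hom(Om1, vquot (limg (linfun d0))) := linfun (vpi _).

Lemma tens_balanced w f v : tens (rmul1 w f) v = tens w (lmul1 f v).
Proof. by apply/ffunP=> s; rewrite !ffunE RtM mulrA. Qed.
Lemma tens_lmul f w v : tens (lmul1 f w) v = lmul11 f (tens w v).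
Proof. by apply/ffunP=> s; rewrite !ffunE mulrA. Qed.
Lemma tens_rmul w v f : tens w (rmul1 v f) = rmul11 (tens w v) f.
Proof. by apply/ffunP=> s; rewrite !ffunE RtM mulrA. Qed.
Lemma tensDl w w' v : tens (w + w') v = tens w v + tens w' v.
Proof. by apply/ffunP=> s; rewrite !ffunE mulrDl. Qed.
Lemma tensDr w v v' : tens w (v + v') = tens w v + tens w v'.
Proof. by apply/ffunP=> s; rewrite !ffunE RtD mulrDr. Qed.

Lemma tens_e1 a b : tens (e1 a) (e1 b) = [ffun s => if s == (a, b) then 1 else 0].
Proof.
apply/ffunP=> -[a' b']; rewrite !ffunE xpair_eqE /=.
by case: eqP => _; case: eqP => _; rewrite ?Rt1 ?Rt0 (mulr1, mulr0).
Qed.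

Lemma sum_tens_e1 (w : Om11) :
  w = \sum_a \sum_b lmul11 (w (a, b)) (tens (e1 a) (e1 b)).
Proof.
rewrite pair_big /=; apply/ffunP=> s; rewrite sum_ffunE (bigD1 s) //=.
rewrite tens_e1 !ffunE -surjective_pairing eqxx mulr1.
rewrite big1 ?addr0 // => p nps.
by rewrite tens_e1 !ffunE -surjective_pairing eq_sym (negPf nps) mulr0.
Qed.

Lemma tens_universal (A : zmodType) (beta : Om1 -> Om1 -> A) :
    (forall w w' v, beta (w + w') v = beta w v + beta w' v) ->
    (forall w v v', beta w (v + v') = beta w v + beta w v') ->
    (forall w f v, beta (rmul1 w f) v = beta w (lmul1 f v)) ->
  exists phi : {additive Om11 -> A},
    (forall w v, phi (tens w v) = beta w v) /\
    (forall psi : {additive Om11 -> A},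
       (forall w v, psi (tens w v) = beta w v) -> psi =1 phi).
Proof.
move=> bDl bDr bM.
pose phi (w : Om11) := \sum_a \sum_b beta (lmul1 (w (a, b)) (e1 a)) (e1 b).
have bBl w w' v : beta (w - w') v = beta w v - beta w' v.
  by apply/eqP; rewrite eq_sym subr_eq -bDl subrK.
have phiB : zmod_morphism phi.
  move=> w w'; rewrite /phi -sumrB; apply: eq_bigr => a _.
  rewrite -sumrB; apply: eq_bigr => b _; rewrite -bBl; congr beta.
  by apply/ffunP=> s; rewrite !ffunE mulrBl.
have b0l v : beta 0 v = 0 by apply: (@addrI _ (beta 0 v)); rewrite -bDl !addr0.
have b0r w : beta w 0 = 0.
  by apply: (@addrI _ (beta w 0)); rewrite -bDr !addr0.
pose phiM := GRing.isZmodMorphism.Build Om11 A phi phiB.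
pose phiA : {additive Om11 -> A} := HB.pack phi phiM.
have phi_tens w v : phi (tens w v) = beta w v.
  rewrite [in RHS](sum_e1 w) (big_morph (beta^~ v) (fun x y => bDl x y v) (b0l v)).
  apply: eq_bigr => a _.
  rewrite [in RHS](sum_e1 v) (big_morph (beta _) (bDr _) (b0r _)).
  apply: eq_bigr => b _; rewrite -bM; congr beta.
  apply/ffunP=> s; rewrite !ffunE /=.
  by case: eqP => [->|_]; rewrite ?(mulr1, mulr0, mul0r).
exists phiA; split=> [//|psi psi_tens w].
rewrite /phiA /= /phi [in LHS](sum_tens_e1 w) raddf_sum; apply: eq_bigr => a _.
by rewrite raddf_sum; apply: eq_bigr => b _; rewrite -tens_lmul psi_tens.
Qed.

Variable CJ : {in C &, forall a b, a * b * a^-1 \in C}%g.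

Definition cj (a b : cls) : cls :=
  exist _ (val a * val b * (val a)^-1)%g (CJ (valP a) (valP b)).

(* The left H-linear map with Psi (e_a (x) e_b) = e_(a b a^-1) (x) e_a; it is a
   bimodule map by Psi_rmul. *)
Definition Psi (w : Om11) : Om11 :=
  \sum_a \sum_b lmul11 (w (a, b)) (tens (e1 (cj a b)) (e1 a)).

Lemma Psi_tens a b : Psi (tens (e1 a) (e1 b)) = tens (e1 (cj a b)) (e1 a).
Proof.
rewrite /Psi pair_big (bigD1 (a, b)) //= big1 => [|[a' b'] /= nab].
  by apply/ffunP=> s; rewrite !tens_e1 !ffunE eqxx addr0 mul1r.
by apply/ffunP=> s; rewrite !tens_e1 !ffunE (negPf nab) mul0r.
Qed.

Lemma cj_inj a : injective (cj a).
Proof. by move=> b b' [] /mulIg/mulgI/val_inj. Qed.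

Lemma PsiE w a b : Psi w (cj a b, a) = w (a, b).
Proof.
rewrite /Psi pair_big sum_ffunE (bigD1 (a, b)) //= tens_e1 !ffunE eqxx mulr1.
rewrite big1 ?addr0 // => -[a' b'] /= nab; rewrite tens_e1 !ffunE.
case: eqP => [[eqc eqa]|_]; last by rewrite mulr0.
case/eqP: nab; rewrite -eqa in eqc *; congr (_, _).
by apply/esym/(@cj_inj a)/val_inj.
Qed.

Lemma cj_surj s : exists b, s = (cj s.2 b, s.2).
Proof.
case: s => c a; have [f _ fK] := injF_bij (@cj_inj a).
by exists (f c); rewrite /= fK.
Qed.

Lemma Psi_lmul f w : Psi (lmul11 f w) = lmul11 f (Psi w).
Proof.
apply/ffunP=> s; have [b ->] := cj_surj s.
by rewrite ffunE !PsiE ffunE.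
Qed.

Lemma Psi_rmul w f : Psi (rmul11 w f) = rmul11 (Psi w) f.
Proof.
apply/ffunP=> s; have [b ->] := cj_surj s.
by rewrite ffunE !PsiE ffunE /= !RtRt mulgKV.
Qed.

Fact Psi_is_linear : linear Psi.
Proof.
move=> c w w'; apply/ffunP=> s; have [b ->] := cj_surj s.
by rewrite !ffunE !PsiE !ffunE.
Qed.
HB.instance Definition _ := GRing.isLinear.Build K Om11 Om11 _ Psi Psi_is_linear.

Definition kerIdPsi : {vspace Om11} := lker (\1 - linfun Psi)%VF.

Lemma mem_kerIdPsi w : (w \in kerIdPsi) = (Psi w == w).
Proof.
by rewrite memv_ker add_lfunE opp_lfunE id_lfunE lfunE subr_eq0 eq_sym.
Qed.

Local Notation Omega2 := (vquot kerIdPsi).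

Definition wedge (w v : Om1) : Omega2 := vpi kerIdPsi (tens w v).

(* Independent of the representative, by lmul2_vpi. *)
Definition lmul2 (f : H) (q : Omega2) : Omega2 :=
  vpi kerIdPsi (lmul11 f (vrepr q)).

Lemma lmul2_vpi f w : lmul2 f (vpi kerIdPsi w) = vpi kerIdPsi (lmul11 f w).
Proof.
apply/eqP; rewrite vpi_eq mem_kerIdPsi.
have -> u v : lmul11 f u - lmul11 f v = lmul11 f (u - v).
  by apply/ffunP=> s; rewrite !ffunE mulrBr.
have:= vrepr_vpi kerIdPsi w; rewrite mem_kerIdPsi Psi_lmul => /eqP->.
exact: eqxx.
Qed.

Definition de (a : cls) : Omega2 := wedge theta (e1 a) + wedge (e1 a) theta.

(* The map determined by d1_lmul. *)
Definition d1 (w : Om1) : Omega2 :=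
  \sum_a (wedge (d0 (w a)) (e1 a) + lmul2 (w a) (de a)).

Lemma d1E w : d1 w = vpi kerIdPsi [ffun s => Rt (val s.1) (w s.2) + w s.1].
Proof.
rewrite /d1 /de /wedge.
under eq_bigr do rewrite -vpiD lmul2_vpi -vpiD.
rewrite -linear_sum; congr vpi; apply/ffunP=> -[a b].
rewrite sum_ffunE [RHS]ffunE /=.
transitivity (\sum_i ((if b == i then Rt (val a) (w i) else 0) +
                      (if a == i then w i else 0))).
  apply: eq_bigr => i _; rewrite !ffunE /= !d0E thetaE mul1r.
  rewrite thetaE Rt1 mulr1.
  rewrite mulrDr addrA.
  rewrite (_ : w i * (if a == i then 1 else 0) = if a == i then w i else 0).
    by case: (b == i); rewrite ?Rt1 ?Rt0 ?mulr1 ?mulr0 ?addr0 ?subrK.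
  by case: (a == i); rewrite ?mulr1 ?mulr0.
rewrite big_split /= -!big_mkcond /=.
by rewrite !(eq_bigl _ _ (fun i => eq_sym _ i)) !big_pred1_eq.
Qed.

Fact d1_is_linear : linear d1.
Proof.
move=> c w w'; rewrite !d1E -linearP; congr vpi.
by apply/ffunP=> s; rewrite !ffunE RtD RtZ scalerDr addrACA.
Qed.
HB.instance Definition _ := GRing.isLinear.Build K Om1 Omega2 _ d1 d1_is_linear.

Lemma d1_lmul f a :
  d1 (lmul1 f (e1 a)) = wedge (d0 f) (e1 a) + lmul2 f (de a).
Proof.
rewrite /d1 (bigD1 a) //= !ffunE eqxx mulr1.
rewrite big1 ?addr0 // => b nba; rewrite !ffunE (negPf nba) mulr0.
rewrite linear0 /de /wedge -vpiD lmul2_vpi -vpiD.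
apply/eqP; rewrite vpi_eq0.
rewrite [X in X \in _](_ : _ = 0) ?mem0v //.
by apply/ffunP=> s; rewrite !ffunE !mul0r addr0.
Qed.

Lemma d1d0 f : d1 (d0 f) = 0.
Proof.
rewrite d1E; apply/eqP; rewrite vpi_eq0.
rewrite mem_kerIdPsi; apply/eqP/ffunP=> s; have [b ->] := cj_surj s.
by rewrite PsiE !ffunE /= !d0E !RtB !RtRt /= mulgKV !addrA !subrK.
Qed.

Lemma limg_d0_closed : (limg (linfun d0) <= lker (linfun d1))%VS.
Proof.
by apply/subvP=> _ /memv_imgP[f _ ->]; rewrite memv_ker !lfunE /= d1d0.
Qed.

(* The quotient ker d1 / im d0, as the subspace of Om1 / im d0 formed by the
   cosets of the closed forms; im d0 is contained in ker d1 by limg_d0_closed. *)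
Definition deRham1 : {vspace vquot (limg (linfun d0))} :=
  (dRclass @: lker (linfun d1))%VS.

End Forms.

(* In perm, s * t is "first s, then t"; the point i of {1, 2, 3, 4} is i - 1
   in 'I_4. *)
Definition A4 : finGroupType := subg_of ('Alt_'I_4)%G.

Definition pt (i : nat) : 'I_4 := inord i.-1.

(* The cycle (i j k): i |-> j |-> k |-> i. *)
Definition cycle3 (i j k : nat) : {perm 'I_4} :=
  (tperm (pt i) (pt j) * tperm (pt i) (pt k))%g.

Lemma pt_eq i j :
  (0 < i <= 4)%N -> (0 < j <= 4)%N -> (pt i == pt j) = (i == j).
Proof.
case: i j => [|i] [|j] //= lei lej.
by rewrite /pt -val_eqE /= !inordK // eqSS.
Qed.

Section Cycle3.
Variables i j k : nat.
Hypotheses (nij : pt i != pt j) (nik : pt i != pt k) (njk : pt j != pt k).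

Lemma cycle3_1 : cycle3 i j k (pt i) = pt j.
Proof. by rewrite permM tpermL tpermD // eq_sym. Qed.
Lemma cycle3_2 : cycle3 i j k (pt j) = pt k.
Proof. by rewrite permM tpermR tpermL. Qed.
Lemma cycle3_3 : cycle3 i j k (pt k) = pt i.
Proof. by rewrite permM (tpermD nik njk) tpermR. Qed.
Lemma cycle3_out l :
  pt i != l -> pt j != l -> pt k != l -> cycle3 i j k l = l.
Proof. by move=> nil njl nkl; rewrite permM !tpermD. Qed.
Lemma cycle3_Alt : cycle3 i j k \in ('Alt_'I_4)%g.
Proof. by rewrite Alt_even odd_permM !odd_tperm nij nik. Qed.
End Cycle3.

(* subg is a total projection, with sgval (alt3 i j k) = cycle3 i j k by alt3E. *)
Definition alt3 (i j k : nat) : A4 := subg _ (cycle3 i j k).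

Definition tA4 := alt3 1 2 3.
Definition xA4 := alt3 1 3 4.
Definition yA4 := alt3 2 4 3.
Definition zA4 := alt3 1 4 2.

(* The conjugacy class of (1 2 3) in A4: see tetra_class. *)
Definition tetra : {set A4} := [set tA4; xA4; yA4; zA4].

Lemma alt3E i j k : pt i != pt j -> pt i != pt k ->
  sgval (alt3 i j k) = cycle3 i j k.
Proof. by move=> nij nik; rewrite subgK // cycle3_Alt. Qed.

Lemma alt3J i j k i' j' k' (g : A4) :
    pt i != pt j -> pt i != pt k -> pt i' != pt j' -> pt i' != pt k' ->
    sgval g (pt i) = pt i' -> sgval g (pt j) = pt j' ->
    sgval g (pt k) = pt k' ->
  (alt3 i j k ^ g = alt3 i' j' k')%g.
Proof.
move=> nij nik nij' nik' gi gj gk; apply: val_inj.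
rewrite (_ : val _ = sgval (alt3 i j k) ^ sgval g)%g // [RHS]alt3E // alt3E //.
by rewrite /cycle3 conjMg !tpermJ gi gj gk.
Qed.

Lemma card_tetra : #|tetra| = 4.
Proof.
pose f (s : A4) := sgval s (pt 1).
have Ef : map f [:: tA4; xA4; yA4; zA4] = [:: pt 2; pt 3; pt 1; pt 4].
  rewrite /f /= !alt3E ?pt_eq //.
  by rewrite !cycle3_1 ?pt_eq // cycle3_out ?pt_eq.
have Uf : uniq [:: tA4; xA4; yA4; zA4].
  by apply: (@map_uniq _ _ f); rewrite Ef /= !inE !pt_eq.
rewrite -[4](card_uniqP Uf); apply: eq_card => s.
by rewrite !inE -!orbA.
Qed.

Lemma tetra_class : tetra = (tA4 ^: [set: A4])%g.
Proof.
have tJ g : (tA4 ^ g)%g \in (tA4 ^: [set: A4])%g.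
  by rewrite memJ_class ?inE.
apply/eqP; rewrite eqEcard; apply/andP; split.
  apply/subsetP=> s; rewrite !inE -!orbA => /or4P[] /eqP->.
  - exact: class_refl.
  - rewrite /xA4 -(@alt3J 1 2 3 1 3 4 (alt3 2 3 4)) ?tJ ?pt_eq //.
    + by rewrite alt3E ?cycle3_out ?pt_eq.
    + by rewrite alt3E ?cycle3_1 ?pt_eq.
    by rewrite alt3E ?cycle3_2 ?pt_eq.
  - rewrite /yA4 -(@alt3J 1 2 3 2 4 3 (alt3 1 2 4)) ?tJ ?pt_eq //.
    + by rewrite alt3E ?cycle3_1 ?pt_eq.
    + by rewrite alt3E ?cycle3_2 ?pt_eq.
    by rewrite alt3E ?cycle3_out ?pt_eq.
  rewrite /zA4 -(@alt3J 1 2 3 1 4 2 (alt3 2 4 3)) ?tJ ?pt_eq //.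
  + by rewrite alt3E ?cycle3_out ?pt_eq.
  + by rewrite alt3E ?cycle3_1 ?pt_eq.
  by rewrite alt3E ?cycle3_3 ?pt_eq.
rewrite card_tetra -index_cent1.
have card12 : #|[set: A4]| = 12.
  have := @card_Alt 'I_4; rewrite card_ord => /(_ isT) card24.
  have -> : #|[set: A4]| = #|('Alt_'I_4)%g|.
    by rewrite cardsT card_sub; apply: eq_card.
  by apply/eqP; rewrite -(eqn_pmul2l (isT : 0 < 2)%N) card24.
set Z := 'C_(_)[_]%g; rewrite -(leq_pmul2r (cardG_gt0 Z)) mulnC.
rewrite Lagrange ?subsetIl // card12.
have: (2 < #|Z|)%N.
  pose f (s : A4) := sgval s (pt 1).
  have U : uniq [:: 1%g; tA4; (tA4 * tA4)%g].
    apply: (@map_uniq _ _ f); rewrite /f [map _ _]/= perm1 permM !alt3E ?pt_eq //.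
    by rewrite cycle3_1 ?pt_eq // cycle3_2 ?pt_eq //= !inE !pt_eq.
  have Zt : tA4 \in Z by apply/setIP; rewrite in_setT cent1id.
  have card3 : #|[:: 1%g; tA4; (tA4 * tA4)%g]| = 3 by rewrite (card_uniqP U).
  apply: leq_trans (_ : #|[:: 1%g; tA4; (tA4 * tA4)%g]| <= _)%N.
    by rewrite card3.
  apply/subset_leq_card/subsetP=> s.
  by rewrite !in_cons orbF => /or3P[]/eqP->; rewrite ?group1 ?groupM.
by move=> lt2Z; rewrite (leq_trans _ (leq_mul (leqnn 4) lt2Z)).
Qed.

Lemma tetra_conj : {in tetra &, forall a b, a * b * a^-1 \in tetra}%g.
Proof.
move=> a b _; rewrite tetra_class => Cb.
have -> : (a * b * a^-1 = b ^ a^-1)%g by rewrite conjgE invgK mulgA.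
by rewrite -(class_eqP Cb) memJ_class ?inE.
Qed.

(* Main.v *)
Require Import Defs.
From mathcomp Require Import all_boot all_order all_algebra.
From mathcomp Require Import all_fingroup all_solvable.
From mathcomp Require Import reals complex.

(* A 1-form is a function w_a(g) on the edges g -> g a of the Cayley graph, and
   it is closed when it has the same sum along the paths (a, b) and
   (a b a^-1, a). For a closed w and h in C, the function
   f(g) = w_(g^-1 h g)(g) satisfies (L_h w) - w = d f, where
   (L_h w)_a(g) = w_a(h g). As C generates the group, every left translate of w
   is cohomologous to w, and so is the average of the translates. The average
   is a closed form with constant coefficients, these are conjugation invariant,
   and C is one conjugacy class, so the average is a multiple of theta.
   Finally theta is not exact, since the sum of the coefficients of d f over the
   group is zero. *)

Set Implicit Arguments.
Unset Strict Implicit.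
Unset Printing Implicit Defensive.

Import GRing.Theory Num.Theory.
Local Open Scope ring_scope.

(** * Groups generated by a single conjugacy class *)

Section ClassCohomology.
Variables (K : fieldType) (gT : finGroupType) (C : {set gT}).
Hypothesis CJ : {in C &, forall a b, a * b * a^-1 \in C}%g.
Variable c0 : gT.
Hypothesis classC : C = (c0 ^: [set: gT])%g.
Hypothesis genC : (<<C>> = [set: gT])%g.

Local Notation cls := {a | a \in C}.
Local Notation H := {ffun gT -> K^o}.
Local Notation Om1 := {ffun cls -> H}.

(** By [PsiE], invariance under [Psi] compares the coefficients at [(cj a b, a)] and [(a, b)], and
    every pair of labels is of the first form. *)
Lemma closedP (w : Om1) :
  reflect (forall a b g, w b (g * val a)%g + w a g =
                         w a (g * val (cj CJ a b))%g + w (cj CJ a b) g)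
          (w \in lker (linfun (d1 CJ))).
Proof.
rewrite memv_ker lfunE /= d1E vpi_eq0 mem_kerIdPsi.
apply: (iffP eqP) => [Pw a b g | w_eq].
  have /ffunP/(_ g) := congr1 (fun v : {ffun cls * cls -> H} => v (cj CJ a b, a)) Pw.
  by rewrite PsiE !ffunE.
apply/ffunP=> s; have [b ->] := cj_surj CJ s.
by apply/ffunP=> g; rewrite PsiE !ffunE w_eq.
Qed.

Lemma exact_limg f : d0 C f \in limg (linfun (@d0 K gT C)).
Proof. by apply/memv_imgP; exists f; rewrite ?memvf // lfunE. Qed.

(** In a finite group, products of generators without inverses reach the whole group. *)
Lemma gen_ind (P : gT -> Prop) :
  P 1%g -> (forall h k, P h -> k \in C -> P (h * k)%g) -> forall h, P h.
Proof.
move=> P1 PM h; have /gen_prodgP[n [c Cc ->]] : h \in <<C>>%g by rewrite genC inE.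
elim: n c Cc => [|n IHn] c Cc; first by rewrite big_ord0.
by rewrite big_ord_recr /=; apply: PM => //; apply: IHn.
Qed.

Definition ltrans (h : gT) (w : Om1) : Om1 := [ffun a => [ffun g => w a (h * g)%g]].

(** The edges are right multiplications, so left translation is a label-preserving automorphism of
    the Cayley graph. *)
Lemma ltrans_closed h w :
  w \in lker (linfun (d1 CJ)) -> ltrans h w \in lker (linfun (d1 CJ)).
Proof.
move/closedP=> w_eq; apply/closedP=> a b g.
by rewrite !ffunE; have := w_eq a b (h * g)%g; rewrite -!mulgA.
Qed.

Lemma conj_mem (h g : gT) : h \in C -> (h ^ g)%g \in C.
Proof. by rewrite classC => Ch; rewrite -(class_eqP Ch) memJ_class ?inE. Qed.

(** The label of the edge from [g] to [val a * g], as [g * (val a ^ g) = val a * g]. *)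
Definition cnj (a : cls) (g : gT) : cls :=
  exist _ (val a ^ g)%g (conj_mem g (valP a)).

(* Cartan homotopy for left translation by an element of [C]. *)
Lemma ltrans_class (a : cls) (w : Om1) :
  w \in lker (linfun (d1 CJ)) ->
  ltrans (val a) w - w = d0 C [ffun g => w (cnj a g) g].
Proof.
move=> /closedP w_eq; apply/ffunP=> b; rewrite d0E; apply/ffunP=> g.
have := w_eq b (cnj a (g * val b)%g) g.
have -> : cj CJ b (cnj a (g * val b)%g) = cnj a g.
  by apply: val_inj; rewrite /= conjgM -conjgC mulgK.
rewrite !ffunE /= -conjgC => w_sq.
by apply/eqP; rewrite subr_eq addrAC eq_sym subr_eq w_sq.
Qed.

Lemma ltrans_cohomologous h w :
  w \in lker (linfun (d1 CJ)) -> ltrans h w - w \in limg (linfun (@d0 K gT C)).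
Proof.
move=> w_closed; elim/gen_ind: h => [|h k IHh Ck].
  suff -> : ltrans 1 w = w by rewrite subrr mem0v.
  by apply/ffunP=> a; apply/ffunP=> g; rewrite !ffunE mul1g.
have -> : ltrans (h * k)%g w = ltrans k (ltrans h w).
  by apply/ffunP=> a; apply/ffunP=> g; rewrite !ffunE mulgA.
(* Telescoping through [ltrans h w]: the new difference is exact by the homotopy for [k] applied to
   that closed form. *)
rewrite -(subrKA (ltrans h w)) memvD //.
by rewrite (ltrans_class (exist _ k Ck)) ?exact_limg ?ltrans_closed.
Qed.

(** For constant coefficients the square condition cancels to invariance under conjugation by [C],
    hence by the whole group. *)
Lemma closed_const_theta (w : Om1) :
  w \in lker (linfun (d1 CJ)) -> (forall a g, w a g = w a 1%g) ->
  exists c, w = c *: theta K C.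
Proof.
move=> /closedP w_eq w_const.
have w_cj a b : w (cj CJ a b) 1%g = w b 1%g.
  have := w_eq a b 1%g; rewrite w_const [w a (_ * _)%g]w_const addrC.
  by move/addrI.
have w_cnj h (a b : cls) : val b = (val a ^ h)%g -> w b 1%g = w a 1%g.
  elim/gen_ind: h a b => [|h k IHh Ck] a b b_eq.
    by congr (w _ _); apply: val_inj; rewrite b_eq conjg1.
  rewrite -(w_cj (exist _ k Ck)); apply: IHh.
  by rewrite /= b_eq conjgM -conjgC mulgK.
have Cc0 : c0 \in C by rewrite classC class_refl.
exists (w (exist _ c0 Cc0) 1%g); apply/ffunP=> a; apply/ffunP=> g.
rewrite !ffunE thetaE ffunE w_const.
have /imsetP[h _ a_eq] : val a \in (c0 ^: [set: gT])%g by rewrite -classC (valP a).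
by rewrite (w_cnj h (exist _ c0 Cc0) a a_eq) [RHS]mulr1.
Qed.

Hypothesis charK : #|gT|%:R != 0 :> K.

Lemma theta_not_exact : theta K C \notin limg (linfun (@d0 K gT C)).
Proof.
have Cc0 : c0 \in C by rewrite classC class_refl.
apply/negP=> /memv_imgP[f _]; rewrite lfunE /=.
(* Summed over the group, the coefficient at [c0] gives [#|gT|] for [theta], nonzero by [charK], and
   zero for [d0 C f]. *)
move/(congr1 (fun w : Om1 => \sum_g w (exist _ c0 Cc0) g)).
rewrite thetaE d0E; under eq_bigr do rewrite ffunE.
under [RHS]eq_bigr do rewrite !ffunE.
rewrite sumr_const sumrB /= [X in X - _](_ : _ = \sum_g f g) ?subrr.
  exact/eqP.
by rewrite [RHS](reindex_inj (mulIg c0)).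
Qed.

Lemma theta_closed : theta K C \in lker (linfun (d1 CJ)).
Proof. by apply/closedP=> a b g; rewrite !thetaE !ffunE. Qed.

Lemma closed_cohomologous_theta w :
  w \in lker (linfun (d1 CJ)) ->
  exists c, w - c *: theta K C \in limg (linfun (@d0 K gT C)).
Proof.
move=> w_closed; pose W := \sum_h ltrans h w.
have W_closed : W \in lker (linfun (d1 CJ)).
  by apply: rpred_sum => h _; apply: ltrans_closed.
have W_exact : W - #|gT|%:R *: w \in limg (linfun (@d0 K gT C)).
  rewrite scaler_nat -[#|gT|]cardsT -sumr_const.
  rewrite (eq_bigl predT) => [|h]; last by rewrite inE.
  by rewrite -sumrB; apply: rpred_sum => h _; apply: ltrans_cohomologous.
(* Constancy of [W]: substituting [h * g] for [h] turns its value at 1 into its value at [g]. *)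
have [a g|c W_eq] := closed_const_theta W_closed.
  rewrite /W !sum_ffunE; under eq_bigr do rewrite !ffunE.
  under [RHS]eq_bigr do rewrite !ffunE mulg1.
  by rewrite [RHS](reindex_inj (mulIg g)).
exists (#|gT|%:R^-1 * c).
have -> : w - (#|gT|%:R^-1 * c) *: theta K C =
          - (#|gT|%:R^-1 *: (W - #|gT|%:R *: w)).
  by rewrite scalerBr scalerA mulVf // scale1r opprB W_eq scalerA.
by rewrite memvN memvZ.
Qed.

Lemma deRham1_class :
  deRham1 K CJ = <[dRclass K C (theta K C)]>%VS /\ \dim (deRham1 K CJ) = 1%N.
Proof.
have dRE w : dRclass K C w = vpi (limg (linfun (@d0 K gT C))) w by rewrite lfunE.
have -> : deRham1 K CJ = <[dRclass K C (theta K C)]>%VS.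
  apply/eqP; rewrite eqEsubv -memvE memv_img ?theta_closed // andbT.
  apply/subvP=> _ /memv_imgP[w w_closed ->].
  have [c] := closed_cohomologous_theta w_closed.
  by rewrite -vpi_eq -!dRE linearZ => /eqP ->; rewrite memvZ ?memv_line.
by rewrite dim_vline dRE vpi_eq0 theta_not_exact.
Qed.

End ClassCohomology.

(** * Generation of [A4] by its class of 3-cycles *)

Lemma cycle3E i j k l :
    (0 < i <= 4)%N -> (0 < j <= 4)%N -> (0 < k <= 4)%N -> (0 < l <= 4)%N ->
    uniq [:: i; j; k] ->
  cycle3 i j k (pt l) =
    pt (if l == i then j else if l == j then k else if l == k then i else l).
Proof.
move=> Bi Bj Bk Bl /=; rewrite !inE negb_or -!(pt_eq Bi, pt_eq Bj) //.
case/and3P=> /andP[nij nik] njk _.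
have [->|nli] := eqVneq l i; first exact: cycle3_1.
have [->|nlj] := eqVneq l j; first exact: cycle3_2.
have [->|nlk] := eqVneq l k; first exact: cycle3_3.
by rewrite cycle3_out ?pt_eq // eq_sym.
Qed.

Lemma card_A4 : #|A4| = 12.
Proof.
have := @card_Alt 'I_4; rewrite card_ord => /(_ isT) card24.
have -> : #|A4| = #|('Alt_'I_4)%g| by rewrite card_sub; apply: eq_card.
by apply/eqP; rewrite -(eqn_pmul2l (isT : 0 < 2)%N) card24.
Qed.

Lemma alt3_pt i j k l :
    (0 < i <= 4)%N -> (0 < j <= 4)%N -> (0 < k <= 4)%N -> (0 < l <= 4)%N ->
    uniq [:: i; j; k] ->
  sgval (alt3 i j k) (pt l) =
    pt (if l == i then j else if l == j then k else if l == k then i else l).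
Proof.
move=> Bi Bj Bk Bl Uijk; rewrite alt3E ?cycle3E // pt_eq //.
  by case/andP: Uijk; rewrite !inE negb_or => /andP[].
by case/andP: Uijk; rewrite !inE negb_or => /andP[].
Qed.

(** The generated subgroup contains seven distinct elements and its order divides 12, so the order
    is 12. *)
Lemma gen_tetra : (<<tetra>> = [set: A4])%g.
Proof.
(* The images of the points 1 and 2 already tell the seven elements apart. *)
pose f (s : A4) := (sgval s (pt 1), sgval s (pt 2)).
pose r := [:: 1%g; tA4; xA4; yA4; zA4; (tA4 * tA4)%g; (xA4 * xA4)%g].
have Ur : uniq r.
  have fM s s' : f (s * s')%g = (sgval s' (f s).1, sgval s' (f s).2).
    by congr (_, _); apply: permM.
  have f1 : f 1%g = (pt 1, pt 2) by congr (_, _); apply: perm1.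
  have ft : f tA4 = (pt 2, pt 3) by rewrite /f !alt3_pt.
  have fx : f xA4 = (pt 3, pt 2) by rewrite /f !alt3_pt.
  have fy : f yA4 = (pt 1, pt 4) by rewrite /f !alt3_pt.
  have fz : f zA4 = (pt 4, pt 1) by rewrite /f !alt3_pt.
  have ftt : f (tA4 * tA4)%g = (pt 3, pt 1) by rewrite fM ft !alt3_pt.
  have fxx : f (xA4 * xA4)%g = (pt 4, pt 2) by rewrite fM fx !alt3_pt.
  apply: (@map_uniq _ _ f); rewrite [map _ _]/= f1 ft fx fy fz ftt fxx.
  by rewrite /= !inE !xpair_eqE !pt_eq.
have sub_r : {subset r <= <<tetra>>%g}.
  have [Gt Gx Gy Gz] : [/\ tA4 \in <<tetra>>%g, xA4 \in <<tetra>>%g,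
                           yA4 \in <<tetra>>%g & zA4 \in <<tetra>>%g].
    by split; apply: mem_gen; rewrite !inE eqxx ?orbT.
  by apply/allP; rewrite /= group1 Gt Gx Gy Gz !groupM.
have le7 : (7 <= #|<<tetra>>%g|)%N.
  by rewrite cardE (uniq_leq_size Ur) // => s /sub_r; rewrite mem_enum.
apply/eqP; rewrite eqEcard subsetT cardsT card_A4 /=.
have := cardSg (subsetT <<tetra>>%G); rewrite cardsT card_A4.
move: le7; rewrite /=; case: #|_| => // n; do 12?case: n => [|n] //.
Qed.

Theorem proposition6p1 (R : realType) :
  deRham1 R[i] tetra_conj = <[dRclass R[i] tetra (theta R[i] tetra)]>%VS /\
  \dim (deRham1 R[i] tetra_conj) = 1%N.
Proof.
apply: (deRham1_class tetra_conj tetra_class gen_tetra).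
by rewrite card_A4 pnatr_eq0.
Qed.
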